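(* Let $\alpha$ be a composition of $n$ with exactly two parts. Then $\mathcal{S}_\alpha$ is F-multiplicity free if and only if $\alpha$ is one of: (i) $(n-1,1)$ or $(1,n-1)$, for $n\ge 2$; (ii) $(n-2,2)$ or $(2,n-2)$, for $n\ge 4$; (iii) $(n-3,3)$, for $n\ge 6$; (iv) $(3,4)$, $(4,4)$, $(4,5)$.
   Context: For a composition $\alpha=(\alpha_1,\dots,\alpha_k)\vDash n$ let $\mathrm{set}(\alpha)=\{\alpha_1,\alpha_1+\alpha_2,\dots,\alpha_1+\cdots+\alpha_{k-1}\}$. The fundamental quasisymmetric function is $F_\alpha=\sum x_{i_1}\cdots x_{i_n}$ over $i_1\le\cdots\le i_n$ with $i_j<i_{j+1}$ whenever $j\in\mathrm{set}(\alpha)$. The composition diagram of $\alpha$ has $\alpha_i$ left-justified cells in row $i$ (top to bottom). Cover relation on compositions: $\beta\lessdot\gamma$ if $\gamma=(1)\cdot\beta$ (new top row of one cell, existing rows keep their cells) or $\gamma$ is obtained from $\beta$ by adding $1$ to the leftmost part of $\beta$ equal to $k$, for some $k$ (a cell added at the right end of that row). A standard composition tableau (SCT) of shape $\alpha\vDash n$ comes from a chain $\emptyset=\alpha^{n+1}\lessdot\cdots\lessdot\alpha^1=\alpha$ by putting $i$ in the cell added from $\alpha^{i+1}$ to $\alpha^i$. Its descent set is the set of $i$ with $i+1$ in a column weakly right of the column of $i$; $\mathrm{com}(T)$ is the composition with this set. The quasisymmetric Schur function is $\mathcal{S}_\alpha=\sum_T F_{\mathrm{com}(T)}$ over SCT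 $T$ of shape $\alpha$. A quasisymmetric function $\sum c_\beta F_\beta$ is F-multiplicity free if all $c_\beta\in\{0,1\}$. *)

(* Defs.v *)
From mathcomp Require Import all_boot all_order all_algebra.
From mathcomp Require Import finmap multiset.

Set Implicit Arguments.
Unset Strict Implicit.
Unset Printing Implicit Defensive.

Definition is_comp (a : seq nat) : bool := all (fun k => 0 < k) a.

Definition is_comp_of (n : nat) (a : seq nat) : bool :=
  is_comp a && (sumn a == n).

(* The partial sums of [a] except the last one, in increasing order. *)
Definition set_of_comp (a : seq nat) : seq nat :=
  take (size a).-1 (scanl addn 0 a).

(* Inverse of [set_of_comp]: [D] is an increasing list of elements of
   {1, ..., n-1}; the parts are the successive differences of 0, D, n. *)
Definition comp_of_set (n : nat) (D : seq nat) : seq nat :=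
  if n == 0 then [::] else pairmap (fun x y => y - x) 0 (rcons D n).

(* Formal power series in commuting variables x_0, x_1, x_2, ... with integer
   coefficients.  A monomial is the multiset of the indices of its variables,
   so that x_{i_1} ... x_{i_n} is the multiset {i_1, ..., i_n}. *)
Definition fps : Type := {mset nat}%mset -> int.

(* [w] lists the indices i_1, ..., i_n; positions are counted from 1 in
   [set_of_comp] and from 0 in [nth]. *)
Definition F_word (a w : seq nat) : bool :=
  [&& size w == sumn a, sorted leq w
    & all (fun j => nth 0 w j.-1 < nth 0 w j) (set_of_comp a)].

(* [permutations m] lists without repetition the words whose product of
   variables is the monomial [m]. *)
Definition F (a : seq nat) : fps :=
  fun m => Posz (count (F_word a) (permutations m)).

(* The compositions covering [b]; [index k b] is the leftmost row of length
   [k]. *)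
Definition covers (b : seq nat) : seq (seq nat) :=
  (1 :: b) :: [seq incr_nth b (index k b) | k <- b].

(* The saturated chains with [n] steps starting from the empty composition,
   each written from its largest element down to the empty composition. *)
Fixpoint chains (n : nat) : seq (seq (seq nat)) :=
  if n is n'.+1 then [seq g :: c | c <- chains n', g <- covers (head [::] c)]
  else [:: [:: [::]]].

Lemma mem_chains n c :
  (c \in chains n) =
  [&& size c == n.+1, last [::] c == [::]
    & sorted (fun g b => g \in covers b) c].
Proof.
elim: n c => [|n IHn] c.
  by case: c => [|g [|b c]]; rewrite // inE /= ?eqseq_cons ?andbT ?andbF.
apply/allpairsPdep/and3P => [[c' [g' []]]|[]].
  rewrite IHn => /and3P[/eqP sz_c' last_c' sort_c'] cov_g' ->.
  by case: c' => [|b c'] //= in sz_c' last_c' sort_c' cov_g' *;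
    rewrite sz_c' last_c' cov_g' sort_c' eqxx.
case: c => [|g [|b c]] //= sz_c last_c /andP[cov_g path_c].
by exists (b :: c), g; rewrite IHn; split=> //; apply/and3P; split.
Qed.

(* A tableau is the list, from top to bottom, of its rows, each listed from
   left to right. *)
Definition tableau : Type := seq (seq nat).

(* [place i b g U] puts [i] in the cell added from [b] to [g], where [U] is a
   filling of [b]; a cover adds a row exactly when it is of the form
   [1 :: b]. *)
Definition place (i : nat) (b g : seq nat) (U : tableau) : tableau :=
  if size b < size g then [:: i] :: U
  else let r := find (fun p => p.1 != p.2) (zip b g) in
       set_nth [::] U r (rcons (nth [::] U r) i).

Fixpoint filling (i : nat) (c : seq (seq nat)) : tableau :=
  if c is g :: ((b :: _) as c') then place i b g (filling i.+1 c') else [::].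

(* [covers], hence [chains], may have repetitions; after [undup] each tableau
   is listed once. *)
Definition SCTs (a : seq nat) : seq (seq (seq nat)) :=
  undup [seq filling 1 c | c <- chains (sumn a) & head [::] c == a].

(* Columns are counted from 0. *)
Definition column (T : tableau) (i : nat) : nat :=
  index i (nth [::] T (find (fun r => i \in r) T)).

Definition descents (T : tableau) : seq nat :=
  [seq i <- iota 1 (sumn (shape T)).-1 | column T i <= column T i.+1].

Definition com (T : tableau) : seq nat :=
  comp_of_set (sumn (shape T)) (descents T).

Definition quasiSchur (a : seq nat) : fps :=
  fun m => (\sum_(T <- SCTs a) F (com T) m)%R.

Definition F_expansion (f : fps) (c : {fsfun seq nat -> int with 0%R}) : Prop :=
  {in finsupp c, forall b, is_comp b} /\
  f =1 (fun m => \sum_(b <- finsupp c) c b * F b m)%R.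

(* The F_b are linearly independent, so the expansion is unique. *)
Definition F_multiplicity_free (f : fps) : Prop :=
  exists c : {fsfun seq nat -> int with 0%R},
    F_expansion f c /\ forall b, c b = 0%R \/ c b = 1%R.

(* Main.v *)
(** A standard composition tableau with two rows is a lattice path recording, from
    the largest entry to the smallest, whether a cell is added to the top or to
    the bottom row; the leftmost-part rule says that a bottom step may not leave
    the diagonal (equal nonzero row lengths).  A descent is a turn of the path that
    heads towards the diagonal: bottom-to-top strictly below it and
    top-to-bottom strictly above it.  As the [F_b] are linearly independent,
    multiplicity freeness means that a path is determined by the times of its
    descents.  When one row is short there are few turns and this is checked on
    the run lengths; the shapes [(3,4)], [(4,4)], [(4,5)] are checked by
    enumeration.  Otherwise a collision of two paths with equal descent times
    is extended from one of four small collisions, of shapes [(5,4)], [(5,5)],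
    [(3,5)] and [(5,6)], by appending the same one or two steps to both paths. *)

Require Import Defs.
From mathcomp Require Import all_boot all_order all_algebra.
From mathcomp Require Import finmap multiset zify.

Import GRing.Theory Num.Theory.

Set Implicit Arguments.
Unset Strict Implicit.
Unset Printing Implicit Defensive.

(** * Two-row lattice paths *)

(* Words list the steps from the last one, which adds the entry 1, to the first
   one; [true] adds a cell to the top row and [false] to the bottom row. *)
Notation top_len w := (count_mem true w).
Notation bot_len w := (count_mem false w).

(** New rows enter on top, so the bottom row is started first. If both rows have the same nonzero
    length, the leftmost-part rule gives the cell to the top one. *)
Fixpoint valid (w : seq bool) : bool :=
  if w is s :: u then
    valid u && (if s then 0 < bot_len u
                else (top_len u == 0) || (top_len u != bot_len u))
  else true.

(** For [s != s'] the counts are the columns of the last entry and of the one before it. Two equal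
    steps give no descent, as a row grows to the right. *)
Definition turn (w : seq bool) : bool :=
  if w is s :: s' :: u then (s != s') && (count_mem s u <= count_mem s' u)
  else false.

(* The time of a descent is the number of steps before it, so that the entry
   [i] of a tableau of size [n] is a descent at time [n - i]. *)
Fixpoint turn_times (w : seq bool) : seq nat :=
  if w is _ :: u then
    if turn w then size u :: turn_times u else turn_times u
  else [::].

Definition words (a b : nat) : pred (seq bool) :=
  fun w => [&& valid w, top_len w == a & bot_len w == b].

Lemma size_words a b w : words a b w -> size w = a + b.
Proof.
case/and3P=> _ /eqP <- /eqP <-; rewrite -(count_predC (pred1 true)).
by congr (_ + _); apply: eq_count; case.
Qed.

Definition turn_free (a b : nat) : Prop :=
  forall w1 w2, words a b w1 -> words a b w2 ->
    turn_times w1 = turn_times w2 -> w1 = w2.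

Definition turn_collision (a b : nat) : Prop :=
  exists w1 w2, [/\ words a b w1, words a b w2, w1 <> w2 &
    turn_times w1 = turn_times w2].

Lemma collision_not_free a b : turn_collision a b -> ~ turn_free a b.
Proof. by case=> w1 [w2 [h1 h2 ne e]] /(_ _ _ h1 h2 e). Qed.

(** * Shapes with collisions *)

(** On or above the diagonal a top step leads away from it, so it adds no turn to either path. *)
Lemma collision_top a b : 0 < b <= a -> turn_collision a b ->
  turn_collision a.+1 b.
Proof.
move=> lt_ba [w1 [w2 [h1 h2 ne e]]]; exists (true :: w1), (true :: w2).
have step w : words a b w ->
    words a.+1 b (true :: w) /\ turn_times (true :: w) = turn_times w.
  case/and3P=> /= v /eqP ta /eqP bb; split.
    by rewrite /words /= v ta bb; lia.
  case: w v ta bb => [|[] u] //= v ta bb; rewrite ifF //; lia.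
have [[v1 e1] [v2 e2]] := (step _ h1, step _ h2).
by split=> //; [case|rewrite e1 e2].
Qed.

(** A bottom step cannot leave the diagonal, so a top step comes first. It is no turn; the bottom
    step after it turns at time [2b + 1] in both paths. *)
Lemma collision_diag b : 0 < b -> turn_collision b b ->
  turn_collision b.+1 b.+1.
Proof.
move=> b_gt0 [w1 [w2 [h1 h2 ne e]]].
exists (false :: true :: w1), (false :: true :: w2).
have step w : words b b w ->
    words b.+1 b.+1 (false :: true :: w)
    /\ turn_times (false :: true :: w) = (b + b).+1 :: turn_times w.
  move=> hw; have sw := size_words hw.
  case/and3P: hw => /= v /eqP ta /eqP bb; split.
    by rewrite /words /= v ta bb; lia.
  rewrite -/(turn_times (true :: w)) sw bb ta leqnn /=.
  case: w v ta bb {sw} => [|[] u] //= v ta bb; rewrite ifF //; lia.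
have [[v1 e1] [v2 e2]] := (step _ h1, step _ h2).
by split=> //; [case|rewrite e1 e2 e].
Qed.

Lemma collision_bot a b : a < b -> turn_collision a b ->
  turn_collision a b.+1.
Proof.
move=> lt_ab [w1 [w2 [h1 h2 ne e]]]; exists (false :: w1), (false :: w2).
have step w : words a b w ->
    words a b.+1 (false :: w) /\ turn_times (false :: w) = turn_times w.
  case/and3P=> /= v /eqP ta /eqP bb; split.
    by rewrite /words /= v ta bb; lia.
  case: w v ta bb => [|[] u] //= v ta bb; rewrite ifF //; lia.
have [[v1 e1] [v2 e2]] := (step _ h1, step _ h2).
by split=> //; [case|rewrite e1 e2].
Qed.

(** Below the diagonal the bottom step is no turn, and the top step after it turns at time
    [a + b + 1] in both paths. *)
Lemma collision_bot_top a b : a < b -> turn_collision a b ->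
  turn_collision a.+1 b.+1.
Proof.
move=> lt_ab [w1 [w2 [h1 h2 ne e]]].
exists (true :: false :: w1), (true :: false :: w2).
have step w : words a b w ->
    words a.+1 b.+1 (true :: false :: w)
    /\ turn_times (true :: false :: w) = (a + b).+1 :: turn_times w.
  move=> hw; have sw := size_words hw.
  case/and3P: hw => /= v /eqP ta /eqP bb; split.
    by rewrite /words /= v ta bb; lia.
  rewrite -/(turn_times (false :: w)) sw bb ta (ltnW lt_ab) /=.
  case: w v ta bb {sw} => [|[] u] //= v ta bb; rewrite ifF //; lia.
have [[v1 e1] [v2 e2]] := (step _ h1, step _ h2).
by split=> //; [case|rewrite e1 e2 e].
Qed.

Lemma collision_5_4 : turn_collision 5 4.
Proof.
(* Both paths turn exactly at times 1, 4 and 7. *)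
exists [:: false; false; true; true; false; true; true; true; false].
exists [:: true; false; true; false; false; true; true; true; false].
by split.
Qed.

Lemma collision_5_5 : turn_collision 5 5.
Proof.
(* Both paths turn exactly at times 2, 5 and 8; the first one passes above the diagonal, the second
   one stays below it until the end. *)
exists [:: false; false; true; true; false; true; true; true; false; false].
exists [:: true; true; false; true; true; false; false; true; false; false].
by split.
Qed.

Lemma collision_3_5 : turn_collision 3 5.
Proof.
(* Both paths turn exactly at times 3 and 6. *)
exists [:: false; true; false; true; true; false; false; false].
exists [:: true; true; false; false; true; false; false; false].
by split.
Qed.

Lemma collision_5_6 : turn_collision 5 6.
Proof.
(* These are the two paths of shape [(3,5)], continued by one bottom and two top steps; this adds a
   turn at time 9 to both. *)
exists [:: true; true; false; false; true; false; true; true; false; false;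
  false].
exists [:: true; true; false; true; true; false; false; true; false; false;
  false].
by split.
Qed.

Lemma collision_ge b a : 5 <= b <= a -> turn_collision a b.
Proof.
have diag : 5 <= b -> turn_collision b b.
  elim: b => // b IH; rewrite leq_eqVlt => /predU1P[<-|lt5b].
    exact: collision_5_5.
  by apply: collision_diag; [lia|apply: IH].
elim: a => [|a IH] ab; first lia.
have [<-|ne] := eqVneq b a.+1; first by apply: diag; lia.
by apply: collision_top; [lia|apply: IH; lia].
Qed.

Lemma collision_4 a : 5 <= a -> turn_collision a 4.
Proof.
elim: a => // a IH; rewrite leq_eqVlt => /predU1P[<-|lt5a].
  exact: collision_5_4.
by apply: collision_top; [lia|apply: IH].
Qed.

(** The collision at [(3,5)] is moved to [(a, a+2)], keeping the gap; then the bottom row is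
    lengthened. *)
Lemma collision_lt2 a b : 3 <= a -> a.+2 <= b -> turn_collision a b.
Proof.
move=> a3; elim: b => // b IH; rewrite leq_eqVlt => /predU1P[<-|lt].
  elim: a a3 {IH} => // a IH; rewrite leq_eqVlt => /predU1P[<-|lt].
    exact: collision_3_5.
  by apply: collision_bot_top; [lia|apply: IH].
by apply: collision_bot; [lia|apply: IH].
Qed.

Lemma collision_lt1 a : 5 <= a -> turn_collision a a.+1.
Proof.
elim: a => // a IH; rewrite leq_eqVlt => /predU1P[<-|lt].
  exact: collision_5_6.
by apply: collision_bot_top; [lia|apply: IH].
Qed.

(** * Shapes without collisions *)

Lemma uniq_map_inj (S T : eqType) (f : S -> T) (s : seq S) :
  uniq (map f s) -> {in s &, injective f}.
Proof.
elim: s => //= x s IH /andP[nx us] y z; rewrite !inE.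
case/predU1P=> [->|ys] /predU1P[->|zs] // efyz.
- by rewrite efyz map_f in nx.
- by rewrite -efyz map_f in nx.
- exact: IH.
Qed.

Fixpoint bitseqs (n : nat) : seq (seq bool) :=
  if n is m.+1 then [seq s :: w | s <- [:: true; false], w <- bitseqs m]
  else [:: [::]].

Lemma mem_bitseqs w : w \in bitseqs (size w).
Proof.
elim: w => //= s w IH; rewrite !mem_cat.
by case: s; rewrite !map_f ?orbT.
Qed.

Lemma turn_free_compute a b :
  uniq [seq turn_times w | w <- bitseqs (a + b) & words a b w] ->
  turn_free a b.
Proof.
move=> /uniq_map_inj inj w1 w2 h1 h2; apply: inj; rewrite mem_filter.
  by rewrite h1 -(size_words h1) mem_bitseqs.
by rewrite h2 -(size_words h2) mem_bitseqs.
Qed.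

Lemma turn_free_3_4 : turn_free 3 4.
Proof. by apply: turn_free_compute; vm_compute. Qed.

Lemma turn_free_4_4 : turn_free 4 4.
Proof. by apply: turn_free_compute; vm_compute. Qed.

Lemma turn_free_4_5 : turn_free 4 5.
Proof. by apply: turn_free_compute; vm_compute. Qed.

(** * Decomposition of words into runs *)

Lemma count_mem0_nseq s w : count_mem s w = 0 -> w = nseq (size w) (~~ s).
Proof. by elim: w => //= x w IH; case: x s IH => [] [] // IH /IH {1}->. Qed.

Lemma count_memS_split s k w : count_mem s w = k.+1 ->
  exists x u, w = nseq x (~~ s) ++ s :: u /\ count_mem s u = k.
Proof.
elim: w => //= t w IH; have [->|nts] := eqVneq t s.
  by case=> <-; exists 0, w.
case/IH=> x [u [-> <-]]; exists x.+1, u; split=> //.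
by case: t s nts {IH} => [] [].
Qed.

Lemma valid_nseq_true x u :
  valid (nseq x true ++ u) = valid u && ((x == 0) || (0 < bot_len u)).
Proof.
elim: x => [|x IH] /=; first by rewrite andbT.
by rewrite IH count_cat count_nseq /=; lia.
Qed.

(** A nonempty run of bottom steps must start before the top row exists, start below the diagonal,
    or end no later than on it. *)
Lemma valid_nseq_false x u :
  valid (nseq x false ++ u) = valid u && [|| x == 0, top_len u == 0,
    top_len u < bot_len u | bot_len u + x <= top_len u].
Proof.
elim: x => [|x IH] /=; first by rewrite andbT.
by rewrite IH !count_cat !count_nseq /=; lia.
Qed.

(** Only the first step of a run can turn; the boolean exponent of [nseq] lists its time once or not
    at all. *)
Lemma turn_times_nseq x s u :
  turn_times (nseq x s ++ ~~ s :: u) =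
  nseq ((0 < x) && (count_mem s u <= count_mem (~~ s) u)) (size u).+1
    ++ turn_times (~~ s :: u).
Proof.
elim: x => // -[|x] IH; first by case: s {IH} => /=; case: ifP.
by rewrite -[RHS]IH; case: s {IH}.
Qed.

(** The strict inequality accounts for the step [s] in front of [u], and [y.-1] for the last step of
    the run, which [turn] does not count. *)
Lemma turn_times_cons s y u :
  turn_times (s :: nseq y (~~ s) ++ s :: u) =
  nseq ((0 < y) && (count_mem s u < count_mem (~~ s) u + y.-1))
     (y + size u).+1 ++ turn_times (nseq y (~~ s) ++ s :: u).
Proof.
case: y => [|y]; first by case: s.
rewrite [LHS]/=; case: s => /=.
all: rewrite !count_cat !count_nseq size_cat size_nseq /=.
all: rewrite mul0n mul1n add0n add1n addnS addnC.
all: by case: ifP.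
Qed.

Lemma turn_times_const s z : turn_times (nseq z s) = [::].
Proof. by elim: z => // -[|z] //= IH; rewrite eqxx. Qed.

Lemma turn_times_cons_const s z : turn_times (s :: nseq z (~~ s)) = nseq (0 < z) z.
Proof.
case: z => // z; have := turn_times_const (~~ s) z.+1.
by case: s => /= ->; rewrite count_nseq size_nseq.
Qed.

Lemma valid_const_true z : valid (nseq z true) = (z == 0).
Proof. by rewrite -[nseq _ _]cats0 valid_nseq_true orbF. Qed.

Ltac simp_runs :=
  do 4 rewrite ?(valid_nseq_true, valid_nseq_false, valid_const_true, size_cat,
    count_cat, count_nseq, size_nseq) /=.

(** Splitting on the boolean exponents makes both lists of turn times explicit; lists of equal
    length yield linear equations in the run lengths. *)
Ltac turn_cases :=
  repeat (case: (boolP (_ && _)) => ? /=; try (exfalso; lia));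
  let e := fresh "e" in intro e; try discriminate e;
    try (injection e; clear e; intros); lia.

(** The only bottom step has to come first, so there is a single path. *)
Lemma turn_free_1r a : turn_free a 1.
Proof.
have H w : words a 1 w -> w = nseq a true ++ [:: false].
  case/and3P=> v /eqP ta /eqP /count_memS_split[x [u [ew]]].
  move/count_mem0_nseq; set z := size u => eu.
  move: v ta; rewrite {}ew {}eu /=; simp_runs => v ta.
  have [-> ->] : x = a /\ z = 0 by lia.
  by [].
by move=> w1 w2 /H-> /H->.
Qed.

(** Here [y != 1] forbids a bottom step from [(1,1)]. If [y = 0], there is at most one turn;
    otherwise the turns are at times 1 and [y + 1]. *)
Lemma turn_free_2r a : turn_free a 2.
Proof.
have H w : words a 2 w -> exists x y, [/\ x + y = a, y != 1 &
   w = nseq x true ++ false :: nseq y true ++ [:: false]].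
  case/and3P=> v /eqP ta /eqP /count_memS_split[x [u1 [ew]]].
  case/count_memS_split=> y [u2 [eu1]].
  move/count_mem0_nseq; set z := size u2 => eu2.
  move: v ta; rewrite {}ew {}eu1 {}eu2 [~~ _]/=; simp_runs => v ta.
  (* The innermost run would consist of top steps taken before the bottom row exists. *)
  have ez : z = 0 by lia.
  by exists x, y; rewrite ez in v ta *; split=> //; lia.
move=> w1 w2 /H[x1 [y1 [a1 v1 ->]]] /H[x2 [y2 [a2 v2 ->]]] {H}.
rewrite !(turn_times_nseq _ true) !(turn_times_cons false).
rewrite !(turn_times_nseq _ true); simp_runs => e.
suff [-> ->] : x1 = x2 /\ y1 = y2 by [].
move: e; turn_cases.
Qed.

(** The conditions on [z] and [y + z] forbid bottom steps from [(1,1)] and [(2,2)]. *)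
Lemma turn_free_3r a : turn_free a 3.
Proof.
have H w : words a 3 w -> exists x y z, [/\ x + y + z = a, z != 1,
   y + z != 2 & w = nseq x true ++ false :: nseq y true ++
     false :: nseq z true ++ [:: false]].
  case/and3P=> v /eqP ta /eqP /count_memS_split[x [u1 [ew]]].
  case/count_memS_split=> y [u2 [eu1]].
  case/count_memS_split=> z [u3 [eu2]].
  move/count_mem0_nseq; set t := size u3 => eu3.
  move: v ta; rewrite {}ew {}eu1 {}eu2 {}eu3 [~~ _]/=; simp_runs => v ta.
  have et : t = 0 by lia.
  by exists x, y, z; rewrite et in v ta *; split=> //; lia.
move=> w1 w2 /H[x1 [y1 [z1 [a1 v1 v1' ->]]]] /H[x2 [y2 [z2 [a2 v2 v2' ->]]]] {H}.
rewrite !(turn_times_nseq _ true) !(turn_times_cons false).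
rewrite !(turn_times_nseq _ true) !(turn_times_cons false).
rewrite !(turn_times_nseq _ true); simp_runs => e.
suff [-> -> ->] : [/\ x1 = x2, y1 = y2 & z1 = z2] by [].
split; move: e; turn_cases.
Qed.

(** The only turn is the top step, at time [y]. *)
Lemma turn_free_1l b : turn_free 1 b.
Proof.
have H w : words 1 b w -> exists x y, [/\ x + y = b, 0 < y,
   (x == 0) || (1 < y) & w = nseq x false ++ true :: nseq y false].
  case/and3P=> v /eqP /count_memS_split[x [u1 [ew]]].
  move/count_mem0_nseq; set y := size u1 => eu1 /eqP.
  move: v; rewrite {}ew {}eu1 [~~ _]/=; simp_runs => v tb.
  by exists x, y; split=> //; lia.
move=> w1 w2 /H[x1 [y1 [a1 v1 v1' ->]]] /H[x2 [y2 [a2 v2 v2' ->]]] {H}.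
rewrite !(turn_times_nseq _ false) !(turn_times_cons_const true); simp_runs => e.
suff [-> ->] : x1 = x2 /\ y1 = y2 by [].
move: e; rewrite v1 v2; turn_cases.
Qed.

(** The first top step always turns, at time [z]; the second one turns, at time [y + z + 1], when
    [y > 0]. *)
Lemma turn_free_2l b : turn_free 2 b.
Proof.
have H w : words 2 b w -> exists x y z, [/\ x + y + z = b, 0 < z,
   (y == 0) || (1 < z), [|| x == 0, 2 < y + z | y + z + x <= 2] &
   w = nseq x false ++ true :: nseq y false ++ true :: nseq z false].
  case/and3P=> v /eqP /count_memS_split[x [u1 [ew]]].
  case/count_memS_split=> y [u2 [eu1]].
  move/count_mem0_nseq; set z := size u2 => eu2 /eqP.
  move: v; rewrite {}ew {}eu1 {}eu2 [~~ _]/=; simp_runs => v tb.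
  by exists x, y, z; split=> //; lia.
move=> w1 w2 /H[x1 [y1 [z1 [a1 v1 v1' v1'' ->]]]].
move=> /H[x2 [y2 [z2 [a2 v2 v2' v2'' ->]]]] {H}.
rewrite !(turn_times_nseq _ false) !(turn_times_cons true).
rewrite !(turn_times_nseq _ false) !(turn_times_cons_const true); simp_runs => e.
suff [-> -> ->] : [/\ x1 = x2, y1 = y2 & z1 = z2] by [].
rewrite v1 v2 in e; split; move: e; turn_cases.
Qed.

(** * Linear independence of the fundamental quasisymmetric functions *)

Lemma scanl_addn x a : scanl addn x a = [seq x + y | y <- scanl addn 0 a].
Proof.
elim: a x => //= k a IH x; rewrite IH [in RHS]IH -map_comp; congr cons.
by apply: eq_map => y /=; rewrite addnA.
Qed.

Lemma set_of_comp_cons k l a :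
  set_of_comp [:: k, l & a] = k :: [seq k + j | j <- set_of_comp (l :: a)].
Proof. by rewrite /set_of_comp map_take -scanl_addn. Qed.

Lemma rcons_set_of_comp a : 0 < size a ->
  rcons (set_of_comp a) (sumn a) = scanl addn 0 a.
Proof.
case: a => // k a _; elim: a k => [|l a IH] k; first by rewrite /= addn0.
rewrite set_of_comp_cons rcons_cons.
rewrite -[RHS]/(0 + k :: scanl addn (0 + k) (l :: a)) add0n scanl_addn -IH.
by rewrite map_rcons.
Qed.

Lemma size_set_of_comp a : size (set_of_comp a) = (size a).-1.
Proof. by rewrite size_take size_scanl; case: a => //= k a; rewrite ltnSn. Qed.

Lemma is_comp_path x a : is_comp a -> path ltn x (scanl addn x a).
Proof.
elim: a x => //= k a IH x /andP[k0 /IH->].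
by rewrite -[X in X < _]addn0 ltn_add2l k0.
Qed.

Lemma set_of_comp_bounds a : is_comp a ->
  path ltn 0 (set_of_comp a) /\ {in set_of_comp a, forall j, 0 < j < sumn a}.
Proof.
case: a => // k a /(is_comp_path 0); rewrite -rcons_set_of_comp //.
move: (set_of_comp _) (sumn _) => D n; rewrite rcons_path => /andP[pD lt_n].
split=> // j jD; have /allP/(_ _ jD)-> := order_path_min ltn_trans pD.
have: path ltn 0 (rcons D n) by rewrite rcons_path pD.
rewrite -cats1 cat_path /=; move: jD pD lt_n.
elim: D 0 => //= d D IH x; rewrite inE => /predU1P[->|jD] /andP[_ pD] lt_n _.
  have /allP dD := order_path_min ltn_trans pD.
  have := mem_last d D; rewrite inE => /predU1P[<-//|/dD lt_d].
  exact: ltn_trans lt_d lt_n.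
by apply: (IH d) => //; rewrite pD lt_n.
Qed.

Lemma comp_of_setK n D : path ltn 0 (rcons D n) ->
  set_of_comp (comp_of_set n D) = D.
Proof.
move=> pD.
have n_gt0 : 0 < n.
  by have /allP := order_path_min ltn_trans pD; apply; rewrite mem_rcons mem_head.
rewrite /comp_of_set /set_of_comp eqn0Ngt n_gt0 /= size_pairmap size_rcons /=.
have -> : scanl addn 0 (pairmap (fun x y => y - x) 0 (rcons D n)) = rcons D n.
  elim: (rcons D n) 0 pD => //= d s IH x /andP[lt_xd ps].
  by rewrite subnKC ?IH // ltnW.
by rewrite -cats1 take_size_cat.
Qed.

Lemma is_comp_comp_of_set n D : path ltn 0 (rcons D n) -> is_comp (comp_of_set n D).
Proof.
rewrite /comp_of_set; case: ifP => // _.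
elim: (rcons D n) 0 => //= d s IH x /andP[lt_xd ps].
by rewrite subn_gt0 lt_xd IH.
Qed.

Lemma set_of_compK a : is_comp a -> comp_of_set (sumn a) (set_of_comp a) = a.
Proof.
case: a => // k a /andP[k_gt0 _]; rewrite /comp_of_set ifF; last first.
  by apply/negbTE; rewrite -lt0n /= addn_gt0 k_gt0.
by rewrite rcons_set_of_comp // scanlK // => x y; rewrite addKn.
Qed.

(* [block_word 0 b] is the word of the monomial [x_0^b_0 x_1^b_1 ...]. *)
Fixpoint block_word (i : nat) (a : seq nat) : seq nat :=
  if a is k :: a' then nseq k i ++ block_word i.+1 a' else [::].

Lemma size_block_word i a : size (block_word i a) = sumn a.
Proof. by elim: a i => //= k a IH i; rewrite size_cat size_nseq IH. Qed.

Lemma block_word_ge i a : all (leq i) (block_word i a).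
Proof.
elim: a i => //= k a IH i; rewrite all_cat all_nseq leqnn orbT /=.
by apply: sub_all (IH i.+1) => x; apply: ltnW.
Qed.

Lemma block_word_sorted i a : sorted leq (block_word i a).
Proof.
elim: a i => //= k a IH i; elim: k => [|k IHk] /=; first exact: IH.
rewrite path_min_sorted // all_cat all_nseq leqnn orbT /=.
by apply: sub_all (block_word_ge i.+1 a) => x; apply: ltnW.
Qed.

Lemma block_word_ascent i a j : is_comp a -> 0 < j < sumn a ->
  (nth 0 (block_word i a) j.-1 < nth 0 (block_word i a) j) =
  (j \in set_of_comp a).
Proof.
elim: a i j => [|k a IH] i j; first by case: j.
case/andP=> k_gt0 ca /= /andP[j_gt0 lt_j]; rewrite !nth_cat !size_nseq !nth_nseq.
case: a => [|l a] in IH ca lt_j *.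
  have -> : j.-1 < k by rewrite /= in lt_j; lia.
  have -> : j < k by rewrite /= in lt_j; lia.
  by rewrite ltnn.
rewrite set_of_comp_cons inE; case: (ltngtP j k) => [lt_jk|lt_kj|ejk] /=.
- have -> : j.-1 < k by lia.
  rewrite ltnn; apply/esym/negP => /mapP[x _ ex]; lia.
- have -> : (j.-1 < k) = false by lia.
  have -> : j.-1 - k = (j - k).-1 by lia.
  rewrite IH //; last by rewrite /= in lt_j *; lia.
  by rewrite -[in RHS](subnKC (ltnW lt_kj)) mem_map //; apply: addnI.
- have -> : j.-1 < k by lia.
  rewrite ejk subnn; apply: (all_nthP 0 (block_word_ge i.+1 (l :: a))).
  by rewrite size_block_word; move: ca => /andP[]; rewrite /=; lia.
Qed.

(** The block word increases exactly at the partial sums of [b], so the test asks whether [b]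
    refines [b']. *)
Lemma F_word_block b' b : is_comp b' -> is_comp b ->
  F_word b' (block_word 0 b) =
  (sumn b == sumn b') && all (mem (set_of_comp b)) (set_of_comp b').
Proof.
move=> cb' cb; rewrite /F_word size_block_word block_word_sorted /=.
case: eqVneq => //= es; apply: eq_in_all => j jb'.
have [_ /(_ _ jb') h] := set_of_comp_bounds cb'.
by rewrite block_word_ascent // es.
Qed.

(** A set included in another one that is not larger is equal to it. *)
Lemma F_word_block_min b' b : is_comp b' -> is_comp b -> size b <= size b' ->
  F_word b' (block_word 0 b) = (b' == b).
Proof.
move=> cb' cb le_sz; rewrite F_word_block //.
have [->|ne] := eqVneq b' b; first by rewrite eqxx /=; apply/allP.
apply/negP => /andP[/eqP es /allP sub]; case/eqP: ne.
have [p' _] := set_of_comp_bounds cb'; have [p _] := set_of_comp_bounds cb.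
have s' := path_sorted p'; have s := path_sorted p.
have u' := sorted_uniq ltn_trans ltnn s'.
have [_ eqi] : size (set_of_comp b') = size (set_of_comp b) /\
    set_of_comp b' =i set_of_comp b.
  by have [] := uniq_min_size u' sub _; rewrite // !size_set_of_comp; lia.
rewrite -(set_of_compK cb') -(set_of_compK cb) es; congr comp_of_set.
by apply: (irr_sorted_eq ltn_trans ltnn).
Qed.

(** Among the rearrangements of [w] only [w] itself is sorted. *)
Lemma F_seq_mset a w : sorted leq w -> F a (seq_mset w) = Posz (F_word a w).
Proof.
move=> sw; rewrite /F; congr Posz.
have pw : perm_eq w (seq_mset w) by rewrite perm_sym perm_eq_seq_mset.
rewrite (@eq_in_count _ _ (fun x => F_word a w && (x == w))); last first.
  move=> x; rewrite mem_permutations => px.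
  have [->|ne] := eqVneq x w; first by rewrite andbT.
  rewrite andbF; apply/negP => /and3P[_ sx _]; case/eqP: ne.
  apply: (sorted_eq leq_trans anti_leq sx sw).
  by rewrite (permPl px) perm_sym.
case: (F_word a w) => /=; last by rewrite count_pred0.
by rewrite count_uniq_mem ?permutations_uniq // mem_permutations pw.
Qed.

Lemma F_independent (r : seq (seq nat)) (d : seq nat -> int) :
  uniq r -> {in r, forall b, is_comp b} ->
  (forall m, \sum_(b <- r) d b * F b m = 0)%R -> {in r, forall b, d b = 0%R}.
Proof.
(* Evaluating at the monomial of [b] leaves only terms with fewer parts. *)
move=> ur cr d0 b br; have [k le_k] := ubnP (size b).
elim: k b br le_k => // k IH b br; rewrite ltnS => le_k.
have := d0 (seq_mset (block_word 0 b)); rewrite (bigD1_seq b) //= big1_seq.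
  rewrite F_seq_mset ?block_word_sorted // F_word_block_min ?cr // eqxx.
  by rewrite addr0 mulr1.
move=> b' /andP[ne b'r]; rewrite F_seq_mset ?block_word_sorted //.
have [lt_sz|le_sz] := ltnP (size b') (size b).
  by rewrite IH ?mul0r // (leq_trans lt_sz).
by rewrite F_word_block_min ?cr // (negbTE ne) mulr0.
Qed.

(** * Multiplicity freeness of a sum over a list *)

Lemma sum_count_mem (T : eqType) (r s : seq T) (G : T -> int) :
  uniq r -> {subset s <= r} ->
  (\sum_(b <- r) Posz (count_mem b s) * G b = \sum_(b <- s) G b)%R.
Proof.
move=> ur; elim: s => [|x s IH] sr.
  by rewrite big_nil big1 // => b _; rewrite mul0r.
rewrite big_cons -IH => [|b bs]; last by rewrite sr // inE bs orbT.
under eq_bigr do rewrite /= PoszD mulrDl.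
rewrite big_split /=; congr (_ + _)%R.
rewrite (bigD1_seq x) ?sr ?mem_head //= eqxx mul1r big1 ?addr0 // => b ne.
by rewrite eq_sym (negbTE ne) mul0r.
Qed.

(** By linear independence the coefficient of [F b] is the multiplicity of [b] in [s]. *)
Lemma F_multiplicity_free_sum f (s : seq (seq nat)) :
  {in s, forall b, is_comp b} -> (forall m, f m = \sum_(b <- s) F b m)%R ->
  F_multiplicity_free f <-> uniq s.
Proof.
move=> cs fE; split=> [[c [[cc fc] c01]]|us].
  (* [r] supports both expansions and [d] is their difference. *)
  pose r := undup (s ++ finsupp c).
  pose d b : int := (Posz (count_mem b s) - c b)%R.
  have d0 : {in r, forall b, d b = 0%R}.
    apply: F_independent (undup_uniq _) _ _ => [b|m].
      by rewrite mem_undup mem_cat => /orP[/cs|/cc].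
    under eq_bigr do rewrite mulrBl.
    rewrite sumrB sum_count_mem ?undup_uniq //; last first.
      by move=> b bs; rewrite mem_undup mem_cat bs.
    apply/eqP; rewrite subr_eq0 -fE fc; apply/eqP.
    rewrite [RHS](bigID (mem (finsupp c))) /= [X in (_ + X)%R]big1 ?addr0.
      rewrite -[RHS]big_filter; apply/perm_big/uniq_perm => [||b].
      - exact: fset_uniq.
      - exact/filter_uniq/undup_uniq.
      - rewrite mem_filter mem_undup mem_cat.
        by case: (b \in finsupp c); rewrite ?orbT.
    by move=> b; rewrite memNfinsupp => /eqP->; rewrite mul0r.
  apply: count_mem_uniq => b; have [bs|/count_memPn//] := boolP (b \in s).
  have := d0 b; rewrite mem_undup mem_cat bs => /(_ isT)/eqP.
  rewrite subr_eq0 => /eqP; case: (c01 b) => -> [] //.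
  by move/count_memPn; rewrite bs.
pose c : {fsfun seq nat -> int with 0%R} := [fsfun b in [fset x in s]%fset => 1%R].
have cE b : c b = Posz (b \in s) by rewrite fsfunE !inE; case: ifP.
have suppc : perm_eq (finsupp c) s.
  apply: uniq_perm => // b.
  by rewrite mem_finsupp cE; case: (b \in s).
exists c; split=> [|b]; last by rewrite cE; case: (b \in s); [right|left].
split=> [b|m]; first by rewrite (perm_mem suppc); apply: cs.
rewrite (perm_big _ suppc) fE; apply: eq_big_seq => b bs.
by rewrite cE bs mul1r.
Qed.

(** * Two-row tableaux as lattice paths *)

(** Rows not yet started are dropped, since a composition has positive parts. *)
Definition tab_shape (w : seq bool) : seq nat :=
  [seq k <- [:: top_len w; bot_len w] | 0 < k].

(** The last step places the smallest entry [i] at the right end of its row, so rows decrease. *)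
Fixpoint row_entries (s : bool) (i : nat) (w : seq bool) : seq nat :=
  if w is t :: u then
    if t == s then rcons (row_entries s i.+1 u) i else row_entries s i.+1 u
  else [::].

Definition word_tab (i : nat) (w : seq bool) : tableau :=
  [seq r <- [:: row_entries true i w; row_entries false i w] | r != [::]].

Lemma size_row_entries s i w : size (row_entries s i w) = count_mem s w.
Proof. by elim: w i => //= t u IH i; case: (t == s); rewrite ?size_rcons IH. Qed.

Lemma row_entries_ge s i w e : e \in row_entries s i w -> i <= e.
Proof.
elim: w i => //= t u IH i; case: (t == s); rewrite ?mem_rcons ?inE.
  by case/predU1P=> [->//|/IH/ltnW].
by move/IH/ltnW.
Qed.

Lemma mem_row_entries s i w t : t < size w ->
  (i + t \in row_entries s i w) = (nth false w t == s).
Proof.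
elim: w i t => //= x u IH i [|t] lt_t /=.
  rewrite addn0; case: (x == s); first by rewrite mem_rcons inE eqxx.
  by apply/negP => /row_entries_ge; rewrite ltnn.
have e : (i + t.+1 \in row_entries s i.+1 u) = (nth false u t == s).
  by rewrite addnS -addSn IH.
case: (x == s) => //; rewrite mem_rcons inE e.
by rewrite -[X in _ == X]addn0 eqn_add2l.
Qed.

Lemma index_row_entries s i w t : t < size w -> nth false w t = s ->
  index (i + t) (row_entries s i w) = count_mem s (drop t.+1 w).
Proof.
elim: w i t => //= x u IH i [|t] lt_t /= es.
  rewrite addn0 es eqxx drop0 -cats1 index_cat /= eqxx addn0.
  rewrite ifF ?size_row_entries //.
  by apply/negP => /row_entries_ge; rewrite ltnn.
have e : index (i + t.+1) (row_entries s i.+1 u) = count_mem s (drop t.+1 u).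
  by rewrite addnS -addSn IH.
case: (x == s) => //; rewrite -cats1 index_cat addnS -addSn.
by rewrite mem_row_entries // es eqxx addSn -addnS.
Qed.

Lemma row_entries_nilp s i w : (row_entries s i w == [::]) = (count_mem s w == 0).
Proof. by rewrite -size_eq0 size_row_entries. Qed.

(** The column of an entry is the number of cells that its row had before, placed by equal letters
    further on in [w]. *)
Lemma column_word_tab i w t : t < size w ->
  column (word_tab i w) (i + t) = count_mem (nth false w t) (drop t.+1 w).
Proof.
move=> lt_t; rewrite /column /word_tab /=.
have eT := mem_row_entries true i lt_t; have eF := mem_row_entries false i lt_t.
case E: (nth false w t) eT eF => /= eT eF.
  have -> : row_entries true i w != [::] by apply/eqP=> eq0; rewrite eq0 in eT.
  by rewrite /= eT index_row_entries.
have -> : row_entries false i w != [::] by apply/eqP=> eq0; rewrite eq0 in eF.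
by case: ifP => _; rewrite /= ?eT eF index_row_entries.
Qed.

Lemma shape_word_tab i w : shape (word_tab i w) = tab_shape w.
Proof.
rewrite /word_tab /tab_shape /= !row_entries_nilp -!lt0n.
by do 2!case: ifP => _ //=; rewrite !size_row_entries.
Qed.

Lemma sumn_tab_shape w : sumn (tab_shape w) = size w.
Proof.
have -> : size w = top_len w + bot_len w.
  by elim: w => //= -[] u ->; lia.
by rewrite /tab_shape /=; do 2!case: ifP => /= ?; lia.
Qed.

Lemma descents_word_tab w : descents (word_tab 1 w) =
  [seq i <- iota 1 (size w).-1 | turn (drop i.-1 w)].
Proof.
rewrite /descents shape_word_tab sumn_tab_shape.
apply: eq_in_filter => i; rewrite mem_iota => /andP[i_gt0 lt_i].
case: i => // i in i_gt0 lt_i *.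
have lt1 : i.+1 < size w by lia.
rewrite -[i.+1]add1n -[in X in _ <= X]addnS !column_word_tab //; last lia.
rewrite (drop_nth false lt1) (drop_nth false (ltnW lt1)) /=.
rewrite (drop_nth false lt1).
(* Equal letters put the smaller entry one column further right; for different letters both sides
   compare the same counts. *)
case: (nth false w i) (nth false w i.+1) => [] [] /=; lia.
Qed.

Lemma turn_timesE w : turn_times w =
  [seq size w - i | i <- [seq i <- iota 1 (size w).-1 | turn (drop i.-1 w)]].
Proof.
elim: w => // s [|s' u] IH //.
set P := fun i => turn (drop i.-1 [:: s, s' & u]).
have -> : turn_times [:: s, s' & u] =
  (if P 1 then [:: (size u).+1] else [::]) ++ turn_times (s' :: u).
  by rewrite /P /=; case: ifP.
have PS i : i \in iota 1 (size u) -> P i.+1 = turn (drop i.-1 (s' :: u)).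
  by case: i => [|i]; rewrite mem_iota.
rewrite {}IH [size (s' :: u)]/= -(eq_in_filter PS) {PS}.
rewrite -/P [size _]/= [_.+2.-1]/= -[iota 1 (size u).+1]/(1 :: iota 2 _).
rewrite (iotaDl 1 1) [filter P (1 :: _)]/= filter_map.
move: (P 1) => b; rewrite (_ : filter (preim _ _) _ =
  filter (fun i => P i.+1) (iota 1 (size u))) //.
case: b => /=; rewrite ?subn1 -!map_comp; last exact: eq_map.
by congr cons; apply: eq_map.
Qed.

(** * Chains of compositions with at most two rows *)

Lemma valid_bot_len w : valid w -> 0 < top_len w -> 0 < bot_len w.
Proof. by elim: w => //= -[] u IH /andP[v h] _ /=; lia. Qed.

Lemma size_cover g b : g \in covers b -> size b <= size g.
Proof.
rewrite inE => /predU1P[->|/mapP[k kb ->]] //.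
by rewrite size_incr_nth index_mem kb.
Qed.

Lemma cover_word u g : valid u -> g \in covers (tab_shape u) -> size g <= 2 ->
  exists2 s, valid (s :: u) & g = tab_shape (s :: u).
Proof.
move=> v; have := valid_bot_len v; rewrite /tab_shape /covers /=.
case Et: (top_len u) => [|j]; case Eb: (bot_len u) => [|k] /= bot.
- by rewrite inE => /eqP-> _; exists false; rewrite /= ?v ?Et ?Eb.
- rewrite !inE eqxx /= => /orP[]/eqP-> _.
    by exists true; rewrite /= ?v ?Et ?Eb.
  by exists false; rewrite /= ?v ?Et ?Eb.
- by have := bot isT.
rewrite !inE !eqxx /= => /or3P[]/eqP-> // _.
  by exists true; rewrite /= ?v ?Et ?Eb.
(* For rows of equal length, [index] finds the top one in both cases. *)
case: eqVneq => [<-|ne].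
  by exists true; rewrite /= ?v ?Et ?Eb.
by exists false; rewrite /= ?v ?Et ?Eb ?ne.
Qed.

Lemma tab_shape_cover s u : valid (s :: u) ->
  tab_shape (s :: u) \in covers (tab_shape u).
Proof.
rewrite /= => /andP[v]; have := valid_bot_len v; rewrite /tab_shape /covers.
case: s => /=; case Et: (top_len u) => [|j]; case Eb: (bot_len u) => [|k] //=.
all: rewrite ?inE ?eqxx ?orbT //=.
  by move=> /(_ isT).
by move=> _ ne; rewrite (negbTE ne) /= eqxx !orbT.
Qed.

Lemma place_word_tab i s u : valid (s :: u) ->
  place i (tab_shape u) (tab_shape (s :: u)) (word_tab i.+1 u) =
  word_tab i (s :: u).
Proof.
rewrite /= => /andP[v]; have := valid_bot_len v.
have := row_entries_nilp false i.+1 u; have := row_entries_nilp true i.+1 u.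
rewrite /place /tab_shape /word_tab /=.
move: (row_entries true i.+1 u) (row_entries false i.+1 u) => R1 R2.
have rcons_nil R : (rcons R i == [::]) = false by case: R.
case: s => /=; case: (top_len u) => [|j]; case: (bot_len u) => [|k] //= e1 e2;
  rewrite ?rcons_nil /= ?e1 ?e2 ?(eqP e1) ?(eqP e2) //=.
all: rewrite ?add0n ?add1n ?eqxx ?[_ == _.+2]ltn_eqF //=.
by move=> /(_ isT).
Qed.

(** The number of rows never drops along a chain, so each composition in it has at most two and each
    cover is a step of the path. *)
Lemma chain_word n c : c \in chains n -> size (head [::] c) <= 2 ->
  exists w, [/\ valid w, size w = n, head [::] c = tab_shape w &
    forall i, filling i c = word_tab i w].
Proof.
elim: n c => [|n IH] c; first by rewrite inE => /eqP-> _; exists [::].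
case/allpairsPdep => c' [g [c'n cg ->]] /= sz_g.
have [||u [vu su hu fu]] := IH c'; first by [].
  exact: leq_trans (size_cover cg) sz_g.
rewrite hu in cg; have [s vs gs] := cover_word vu cg sz_g.
exists (s :: u); split=> //; first by rewrite /= su.
move=> i; case: c' c'n hu fu => [|b c'] c'n hu fu.
  by move: c'n; rewrite mem_chains.
by rewrite -place_word_tab // -fu -gs -hu.
Qed.

Lemma word_chain w : valid w -> exists c, [/\ c \in chains (size w),
  head [::] c = tab_shape w & forall i, filling i c = word_tab i w].
Proof.
elim: w => [|s u IH] v; first by exists [:: [::]].
have [|c [cn hc fc]] := IH; first by case/andP: v.
exists (tab_shape (s :: u) :: c); split=> //.
  apply/allpairsPdep; exists c, (tab_shape (s :: u)); split=> //.
  by rewrite hc tab_shape_cover.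
move=> i; case: c cn hc fc => [|b c] cn hc fc.
  by move: cn; rewrite mem_chains.
by rewrite -place_word_tab // -fc -hc.
Qed.

Lemma tab_shape_words a b w : 0 < a -> 0 < b ->
  words a b w = valid w && (tab_shape w == [:: a; b]).
Proof.
case: a b => [|a] [|b] // _ _; rewrite /words /tab_shape /=; congr (_ && _).
case: (top_len w) (bot_len w) => [|j] [|k] //=.
all: by rewrite ?eqseq_cons ?andbT ?andbF.
Qed.

Lemma mem_SCTs a b T : 0 < a -> 0 < b ->
  T \in SCTs [:: a; b] <-> exists2 w, words a b w & T = word_tab 1 w.
Proof.
move=> a_gt0 b_gt0; rewrite mem_undup; split.
  case/mapP => c; rewrite mem_filter => /andP[/eqP hc cn] ->.
  have [|w [vw sw hw fw]] := chain_word cn; first by rewrite hc.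
  by exists w; rewrite // tab_shape_words // vw -hw hc eqxx.
case=> w hw ->; have sw := size_words hw; move: hw.
rewrite tab_shape_words // => /andP[vw /eqP tw].
have [c [cn hc fc]] := word_chain vw; rewrite -fc; apply: map_f.
by rewrite mem_filter hc tw eqxx /= addn0 -sw.
Qed.

(** The top row alone gives the positions of [true]. *)
Lemma word_tab_inj a b : 0 < a -> 0 < b ->
  {in words a b &, injective (word_tab 1)}.
Proof.
move=> a_gt0 b_gt0 w1 w2 h1 h2.
have tabE w : w \in words a b -> word_tab 1 w = [:: row_entries true 1 w;
    row_entries false 1 w].
  case/and3P=> _ /eqP ta /eqP tb; rewrite /word_tab /= !row_entries_nilp.
  by rewrite ta tb -!lt0n a_gt0 b_gt0.
rewrite !tabE // => -[e _].
have sz : size w1 = size w2 by rewrite (size_words h1) (size_words h2).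
apply: (@eq_from_nth _ false) => // t lt_t.
have := mem_row_entries true 1 lt_t; rewrite e mem_row_entries -?sz //.
by case: (nth _ w1 t); case: (nth _ w2 t).
Qed.

(** * Descent compositions and turn times *)

Lemma com_word_tab w : com (word_tab 1 w) =
  comp_of_set (size w) [seq size w - t | t <- turn_times w].
Proof.
rewrite /com shape_word_tab sumn_tab_shape descents_word_tab turn_timesE.
congr comp_of_set; rewrite -map_comp map_id_in // => i.
by rewrite mem_filter mem_iota /= => /andP[_ h]; rewrite subKn //; lia.
Qed.

Lemma turn_path w : 0 < size w ->
  path ltn 0 (rcons [seq size w - t | t <- turn_times w] (size w)).
Proof.
move=> sw; rewrite turn_timesE -map_comp map_id_in; last first.
  by move=> i; rewrite mem_filter mem_iota /= => /andP[_ h]; rewrite subKn //; lia.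
rewrite -cats1; set P := fun i => _.
(* With the last element absorbed into the filter, the list is a sublist of an interval and hence
   increasing. *)
have -> : [seq i <- iota 1 (size w).-1 | P i] ++ [:: size w] =
    [seq i <- iota 1 (size w) | P i || (i == size w)].
  case: (size w) sw => // n _; rewrite [n.+1.-1]/=.
  have -> : iota 1 n.+1 = iota 1 n ++ [:: n.+1] by rewrite -{1}[n.+1]addn1 iotaD.
  rewrite filter_cat /= eqxx orbT.
  congr (_ ++ _); apply: eq_in_filter => i; rewrite mem_iota => h.
  by rewrite [i == _]ltn_eqF ?orbF //; lia.
rewrite path_min_sorted; last first.
  by apply/allP => i; rewrite mem_filter mem_iota => /andP[_ /andP[]].
exact: sorted_filter ltn_trans _ _ (iota_ltn_sorted 1 _).
Qed.

Lemma turn_free_com a b : 0 < a -> 0 < b ->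
  uniq [seq com T | T <- SCTs [:: a; b]] <-> turn_free a b.
Proof.
move=> a_gt0 b_gt0.
have path_w w : words a b w -> path ltn 0
    (rcons [seq size w - t | t <- turn_times w] (size w)).
  by move=> hw; apply: turn_path; rewrite (size_words hw); lia.
have turn_lt w : {in turn_times w, forall t, t <= size w}.
  by move=> t; rewrite turn_timesE => /mapP[i _ ->]; apply: leq_subr.
split=> [/uniq_map_inj inj w1 w2 h1 h2 e|free].
  apply: (word_tab_inj a_gt0 b_gt0 h1 h2); apply: inj.
  - by apply/mem_SCTs => //; exists w1.
  - by apply/mem_SCTs => //; exists w2.
  - by rewrite !com_word_tab (size_words h1) (size_words h2) e.
(* The tableaux are listed without repetition, so it remains to show that [com] is injective on
   them. *)
rewrite map_inj_in_uniq ?undup_uniq // => T1 T2.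
move=> /mem_SCTs-/(_ a_gt0 b_gt0)[w1 h1 ->] /mem_SCTs-/(_ a_gt0 b_gt0)[w2 h2 ->].
rewrite !com_word_tab => /(congr1 set_of_comp).
rewrite !comp_of_setK ?path_w // => e; congr word_tab; apply: free => //.
have timesK w : turn_times w =
    [seq size w - i | i <- [seq size w - t | t <- turn_times w]].
  rewrite -map_comp map_id_in // => t /turn_lt h /=; exact: subKn.
by rewrite timesK [RHS]timesK e (size_words h1) (size_words h2).
Qed.

Lemma quasiSchur_multiplicity_free a b : 0 < a -> 0 < b ->
  F_multiplicity_free (quasiSchur [:: a; b]) <-> turn_free a b.
Proof.
move=> a_gt0 b_gt0; rewrite -turn_free_com //.
apply: F_multiplicity_free_sum => [c /mapP[T]|m]; last by rewrite big_map.
move=> /mem_SCTs-/(_ a_gt0 b_gt0)[w hw ->] ->; rewrite com_word_tab.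
by apply/is_comp_comp_of_set/turn_path; rewrite (size_words hw); lia.
Qed.

Theorem theorem5p1 (n : nat) (alpha : seq nat)
    (alpha_comp : is_comp_of n alpha) (alpha_two_parts : size alpha = 2) :
  F_multiplicity_free (quasiSchur alpha) <->
  [\/ 2 <= n /\ (alpha = [:: n - 1; 1] \/ alpha = [:: 1; n - 1]),
      4 <= n /\ (alpha = [:: n - 2; 2] \/ alpha = [:: 2; n - 2]),
      6 <= n /\ alpha = [:: n - 3; 3]
    | [\/ alpha = [:: 3; 4], alpha = [:: 4; 4] | alpha = [:: 4; 5]]].
Proof.
case: alpha alpha_two_parts alpha_comp => [|a [|b []]] // _.
rewrite /is_comp_of /= andbT addn0 => /andP[/andP[a_gt0 b_gt0] /eqP en].
rewrite quasiSchur_multiplicity_free //.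
split; last first.
  case=> [[_ [[_ ->]|[-> _]]]|[_ [[_ ->]|[-> _]]]|[_ [_ ->]]|
    [[-> ->]|[-> ->]|[-> ->]]].
  - exact: turn_free_1r.
  - exact: turn_free_1l.
  - exact: turn_free_2r.
  - exact: turn_free_2l.
  - exact: turn_free_3r.
  - exact: turn_free_3_4.
  - exact: turn_free_4_4.
  - exact: turn_free_4_5.
move=> free; have noncol h := collision_not_free h free.
have [b1|b1] := eqVneq b 1.
  by apply: Or41; split; [lia|left; congr [:: _; _]; lia].
have [a1|a1] := eqVneq a 1.
  by apply: Or41; split; [lia|right; congr [:: _; _]; lia].
have [b2|b2] := eqVneq b 2.
  by apply: Or42; split; [lia|left; congr [:: _; _]; lia].
have [a2|a2] := eqVneq a 2.
  by apply: Or42; split; [lia|right; congr [:: _; _]; lia].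
have [b3|b3] := eqVneq b 3.
  by apply: Or43; split; [lia|congr [:: _; _]; lia].
(* Now [a >= 3] and [b >= 4]. *)
apply: Or44.
have [le_ba|lt_ab] := leqP b a.
  have [b5|b4] := leqP 5 b; first by case: noncol; apply: collision_ge; lia.
  have eb : b = 4 by lia.
  have [a5|a4] := leqP 5 a.
    by case: noncol; rewrite eb; apply: collision_4.
  by apply: Or32; congr [:: _; _]; lia.
have [lt2|le2] := leqP a.+2 b.
  by case: noncol; apply: collision_lt2; lia.
have eb : b = a.+1 by lia.
have [a5|a4] := leqP 5 a.
  by case: noncol; rewrite eb; apply: collision_lt1.
(* Only [(3,4)] and [(4,5)] are left with [b = a + 1]. *)
have [a3|a3] := eqVneq a 3; first by apply: Or31; congr [:: _; _]; lia.
by apply: Or33; congr [:: _; _]; lia.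
Qed.
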